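(* Let $|\Psi\rangle\in\mathcal{B}^n$ and $|\Psi'\rangle\in\mathcal{B}^k$ be $M$-party stabilizer states with stabilizer groups $S\subset G^n$ and $S'\subset G^k$, where $n=\sum_{\alpha\in M}n_\alpha$, $k=\sum_{\alpha\in M}k_\alpha$ and $0\le k_\alpha\le n_\alpha$ for all $\alpha$. Then $|\Psi'\rangle$ is extractable from $|\Psi\rangle$ if and only if there exists a linear injective map $T:S'\to S$ such that (i) $\omega(T(f)_\alpha,T(g)_\alpha)=\omega(f_\alpha,g_\alpha)$ for all $f,g\in S'$ and $\alpha\in M$ (the left side computed in $G^{n_\alpha}$, the right side in $G^{k_\alpha}$); and (ii) $(T\cdot S')_{\hat\alpha}=T\cdot(S'_{\hat\alpha})$ for all $\alpha\in M$, where $(T\cdot S')_{\hat\alpha}$ is the co-local subspace of the subspace $T(S')\subseteq G^n$ and $S'_{\hat\alpha}$ is the co-local subspace of $S'\subseteq G^k$.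
   Context: Let $G=\{00,01,10,11\}\cong\mathbb{F}_2^2$ and $G^n\cong\mathbb{F}_2^{2n}$, with elements written $f=(a_1,b_1,\dots,a_n,b_n)$. Put $\sigma_{00}=I$, $\sigma_{10}=\sigma^x$, $\sigma_{01}=\sigma^z$, $\sigma_{11}=\sigma^y$ and $\sigma(f)=\sigma_{a_1b_1}\otimes\cdots\otimes\sigma_{a_nb_n}$, an operator on $\mathcal{B}^n=(\mathbb{C}^2)^{\otimes n}$. The symplectic form is $\omega(f,f')=\sum_{j=1}^n(a_jb_j'+b_ja_j')\bmod 2$. For a subspace $S\subseteq G^n$, $S^\perp=\{f\in G^n:\omega(f,g)=0\ \forall g\in S\}$; $S$ is self-dual if $S^\perp=S$. A stabilizer state with stabilizer group $S$ is, for a self-dual $S\subset G^n$ and a sign function $\epsilon:S\to\{\pm1\}$ for which the equations are consistent, the unique (up to global phase) unit vector $|\Psi\rangle$ with $\sigma(f)|\Psi\rangle=\epsilon(f)|\Psi\rangle$ for all $f\in S$. The Clifford group $\mathcal{C}(n)$ is the set of unitaries $U$ on $\mathcal{B}^n$ with $U\sigma(f)U^\dagger=\pm\sigma(u(f))$ for all $f$ for some map $u:G^n\to G^n$. Multipartite setting: $M$ is a finite set of parties, the qubits of a state on $\mathcal B^n$ are distributed so that party $\alpha$ holds $n_\alpha$ of them, $n=\sum_\alpha n_\alpha$. For $f\in G^n$, $f_\alpha\in G^{n_\alpha}$ is the restriction of $f$ to the qubits of party $\alpha$. For a subspace $S\subseteq G^n$, the co-local subspace is $S_{\hat\alpha}=\{g\in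 S:g_\alpha=0\}$ (equal to $S$ if $n_\alpha=0$). Two $M$-party stabilizer states are LCU-equivalent if one equals $\bigotimes_\alpha U_\alpha$ applied to the other (up to global phase), with $U_\alpha\in\mathcal{C}(n_\alpha)$ acting on party $\alpha$'s qubits. Extractability: $|\Psi'\rangle\in\mathcal B^k$ (party $\alpha$ holding $k_\alpha\le n_\alpha$ qubits) is extractable from $|\Psi\rangle\in\mathcal{B}^n$ if $|\Psi\rangle$ is LCU-equivalent to $|\Psi'\rangle\otimes|\Psi''\rangle$ for some $M$-party stabilizer state $|\Psi''\rangle$ in which party $\alpha$ holds $n_\alpha-k_\alpha$ qubits (party $\alpha$'s $n_\alpha$ qubits being split into the $k_\alpha$ qubits of $|\Psi'\rangle$ and the $n_\alpha-k_\alpha$ qubits of $|\Psi''\rangle$). *)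

(* Defs.v *)
(* Qubit systems indexed by a finite type Q of qubits;
   a state of Q is a function on computational-basis configurations
   cfg Q = {ffun Q -> bool}, i.e. an element of (C^2)^{(x) Q}. *)
From HB Require Import structures.
From mathcomp Require Import all_boot all_order all_algebra.
Set Implicit Arguments. Unset Strict Implicit. Unset Printing Implicit Defensive.
Import Order.TTheory GRing.Theory Num.Theory.
Local Open Scope ring_scope.

(* G^Q = (F_2^2)^Q ; a pair (a,b) encodes sigma_{ab} *)
Definition pauli (Q : finType) := {ffun Q -> bool * bool}.
Definition cfg (Q : finType) := {ffun Q -> bool}.
Definition state (C : Type) (Q : finType) := cfg Q -> C.
Definition op (C : Type) (Q : finType) := cfg Q -> cfg Q -> C.

Definition pzero (Q : finType) : pauli Q := [ffun _ => (false, false)].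
Definition padd (Q : finType) (f g : pauli Q) : pauli Q :=
  [ffun q => ((f q).1 (+) (g q).1, (f q).2 (+) (g q).2)].

Definition omega (Q : finType) (f g : pauli Q) : bool :=
  \big[addb/false]_(q : Q) (((f q).1 && (g q).2) (+) ((f q).2 && (g q).1)).

Definition perp (Q : finType) (S : {set pauli Q}) : {set pauli Q} :=
  [set f | [forall g in S, ~~ omega f g]].
Definition self_dual (Q : finType) (S : {set pauli Q}) : Prop := perp S = S.

(* single-qubit Paulis, rows/columns indexed by bits (false = |0>):
   s00 = I, s10 = X, s01 = Z, s11 = Y = [[0,-i],[i,0]] *)
Definition pauli1 (C : numClosedFieldType) (p : bool * bool) (x y : bool) : C :=
  match p with
  | (false, false) => (x == y)%:R
  | (true, false) => (x != y)%:R
  | (false, true) => if x == y then (if x then -1 else 1) else 0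
  | (true, true) => if x == y then 0 else (if x then 'i else - 'i)
  end.

Definition sigma (C : numClosedFieldType) (Q : finType) (f : pauli Q) : op C Q :=
  fun x y => \prod_(q : Q) pauli1 C (f q) (x q) (y q).

Definition op_mul (C : numClosedFieldType) (Q : finType) (A B : op C Q) : op C Q :=
  fun x y => \sum_(z : cfg Q) A x z * B z y.
Definition op_adj (C : numClosedFieldType) (Q : finType) (A : op C Q) : op C Q :=
  fun x y => (A y x)^*.
Definition op_id (C : numClosedFieldType) (Q : finType) : op C Q :=
  fun x y => (x == y)%:R.
Definition op_app (C : numClosedFieldType) (Q : finType) (A : op C Q) (v : state C Q)
  : state C Q := fun x => \sum_(y : cfg Q) A x y * v y.

Definition is_stab_state (C : numClosedFieldType) (Q : finType)
    (S : {set pauli Q}) (Psi : state C Q) : Prop :=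
  [/\ self_dual S,
      \sum_(x : cfg Q) `|Psi x| ^+ 2 = 1 &
      exists eps : pauli Q -> bool, forall f, f \in S ->
        forall x, op_app (sigma C f) Psi x = (-1) ^+ eps f * Psi x].

Definition clifford (C : numClosedFieldType) (Q : finType) (U : op C Q) : Prop :=
  (forall x y, op_mul U (op_adj U) x y = @op_id C Q x y) /\
  exists u : pauli Q -> pauli Q, forall f : pauli Q, exists s : bool,
    forall x y, op_mul (op_mul U (sigma C f)) (op_adj U) x y
                = (-1) ^+ s * sigma C (u f) x y.

Definition party_qubits (M : finType) (Q : finType) (own : Q -> M) (a : M) : finType :=
  {q : Q | own q == a}.

Definition restr_cfg (M Q : finType) (own : Q -> M) (a : M) (x : cfg Q)
  : cfg (party_qubits own a) := [ffun q => x (val q)].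
Definition restr_pauli (M Q : finType) (own : Q -> M) (a : M) (f : pauli Q)
  : pauli (party_qubits own a) := [ffun q => f (val q)].

Definition local_op (C : numClosedFieldType) (M Q : finType) (own : Q -> M)
    (U : forall a : M, op C (party_qubits own a)) : op C Q :=
  fun x y => \prod_(a : M) U a (restr_cfg own a x) (restr_cfg own a y).

Definition LCU_equiv (C : numClosedFieldType) (M Q : finType) (own : Q -> M)
    (Psi1 Psi2 : state C Q) : Prop :=
  exists U : forall a : M, op C (party_qubits own a),
    (forall a, clifford (U a)) /\
    exists c : C, `|c| = 1 /\ forall x, Psi1 x = c * op_app (local_op U) Psi2 x.

Definition tensor_state (C : numClosedFieldType) (Q1 Q2 : finType)
    (Psi1 : state C Q1) (Psi2 : state C Q2) : state C (Q1 + Q2)%type :=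
  fun z => Psi1 [ffun q => z (inl q)] * Psi2 [ffun q => z (inr q)].

Definition sum_owner (M Q1 Q2 : finType) (own1 : Q1 -> M) (own2 : Q2 -> M)
  (r : (Q1 + Q2)%type) : M :=
  match r with inl q => own1 q | inr q => own2 q end.

Definition relabel (C : numClosedFieldType) (Q2 Q : finType) (pi : Q2 -> Q)
    (Phi : state C Q2) : state C Q :=
  fun x => Phi [ffun r => x (pi r)].

(* |Psi'> (k qubits, owners own') is extractable from |Psi> (n qubits, owners own):
   Psi is LCU-equivalent to Psi' (x) Psi'' for an M-party stabilizer state Psi''
   on m qubits, the qubits of each party of Psi being split (via a party-respecting
   bijection pi) between those of Psi' and those of Psi''. *)
Definition extractable (C : numClosedFieldType) (M : finType) (n k : nat)
    (own : 'I_n -> M) (own' : 'I_k -> M) (Psi : state C 'I_n) (Psi' : state C 'I_k)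
    : Prop :=
  exists (m : nat) (own'' : 'I_m -> M) (Psi'' : state C 'I_m)
         (pi : ('I_k + 'I_m)%type -> 'I_n),
    [/\ exists S'' : {set pauli 'I_m}, is_stab_state S'' Psi'',
        bijective pi,
        forall r, own (pi r) = sum_owner own' own'' r &
        LCU_equiv own Psi (relabel pi (tensor_state Psi' Psi''))].

Definition colocal (M Q : finType) (own : Q -> M) (a : M) (S : {set pauli Q})
  : {set pauli Q} := [set g in S | restr_pauli own a g == pzero _].

Definition lin_inj_into (Q' Q : finType) (S' : {set pauli Q'}) (S : {set pauli Q})
    (T : pauli Q' -> pauli Q) : Prop :=
  [/\ {in S' &, forall f g, T (padd f g) = padd (T f) (T g)},
      {in S' &, injective T} &
      T @: S' \subset S].

(* Main.v *)
Require Import Defs.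
From HB Require Import structures.
From mathcomp Require Import all_boot all_order all_algebra.
From Stdlib Require Import FunctionalExtensionality.
Set Implicit Arguments. Unset Strict Implicit. Unset Printing Implicit Defensive.
Import Order.TTheory GRing.Theory Num.Theory.
Local Open Scope ring_scope.

(* If Psi = U (Psi' (x) Psi'') with U a local Clifford acting on Pauli labels by the
   symplectic map u, then T f = u (f (+) 0) satisfies (i) and (ii).

   Conversely, (i) and (ii) say that for each party a, f_a |-> (T f)_a is a well-defined
   injective isometry; by Witt's theorem over F_2 it extends to a product of symplectic
   transvections. The transvection by h is implemented by the Clifford unitary
   (1 + i sigma(h)) / sqrt 2, so after a local Clifford the state is stabilized, up to
   signs, by S' (+) 0. The signs differ from those of Psi' by a character of S', which
   has the form f |-> (-1)^omega(f, h) and is removed by applying sigma(h).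
   As S' determines Psi' up to a scalar, every slice of the state along the
   complementary qubits is a multiple of Psi', so the state is a product. *)

(** * Symplectic geometry over F_2 *)

Section SymplecticForm.
Variable Q : finType.
Implicit Types f g h v w z : pauli Q.

(** Over F_2 the only scalars are 0 and 1, so these two conditions already say that [W] is a linear
    subspace. *)
Definition padd_closed (W : {set pauli Q}) :=
  pzero Q \in W /\ {in W &, forall f g, padd f g \in W}.

Lemma paddC f g : padd f g = padd g f.
Proof. by apply/ffunP=> q; rewrite !ffunE addbC (addbC (f q).2). Qed.

Lemma paddA f g h : padd f (padd g h) = padd (padd f g) h.
Proof. by apply/ffunP=> q; rewrite !ffunE /= !addbA. Qed.

Lemma padd0 f : padd f (pzero Q) = f.
Proof. by apply/ffunP=> q; rewrite !ffunE /= !addbF; case: (f q). Qed.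

Lemma paddff f : padd f f = pzero Q.
Proof. by apply/ffunP=> q; rewrite !ffunE /= !addbb. Qed.

Lemma paddK f g : padd f (padd f g) = g.
Proof. by rewrite paddA paddff paddC padd0. Qed.

Lemma padd_eq0 f g : padd f g = pzero Q -> f = g.
Proof. by move=> fg0; rewrite -(paddK f g) fg0 padd0. Qed.

Lemma omegaC f g : omega f g = omega g f.
Proof.
apply: eq_bigr => q _; case: (f q) (g q) => [a b] [c d] /=.
by rewrite addbC (andbC d) (andbC c).
Qed.

Lemma omegaDl f g h : omega (padd f g) h = omega f h (+) omega g h.
Proof.
rewrite /omega -big_split; apply: eq_bigr => q _; rewrite ffunE /=.
by case: (f q) (g q) (h q) => [[] []] [[] []] [[] []].
Qed.

Lemma omegaDr f g h : omega f (padd g h) = omega f g (+) omega f h.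
Proof. by rewrite omegaC omegaDl !(omegaC f). Qed.

Lemma omegaff f : omega f f = false.
Proof. by rewrite /omega big1 // => q _; rewrite andbC addbb. Qed.

Lemma omega0l f : omega (pzero Q) f = false.
Proof. by rewrite -(paddff f) omegaDl addbb. Qed.

Lemma omega0r f : omega f (pzero Q) = false.
Proof. by rewrite omegaC omega0l. Qed.

Lemma omega_nondegenerate f : (forall z, omega f z = false) -> f = pzero Q.
Proof.
move=> f0; apply/ffunP=> q; rewrite ffunE.
have at_q p : ((f q).1 && p.2) (+) ((f q).2 && p.1) = false.
  (* The test vector carries [p] at [q] and the identity elsewhere, which isolates one summand of
     [omega]. *)
  rewrite -(f0 [ffun r => if r == q then p else (false, false)]) /omega.
  rewrite (bigD1 q) //= ffunE eqxx big1 ?addbF // => r /negPf rq.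
  by rewrite ffunE rq !andbF.
by move: (at_q (true, false)) (at_q (false, true)); case: (f q) => [[] []].
Qed.

(** This is the inclusion of $(W^\perp)^\perp$ in $W$, in contrapositive form. It is proved by
    induction on a list of vectors of [W], so no dimension count enters. *)
Lemma perp_separation (W : {set pauli Q}) v : padd_closed W -> v \notin W ->
  exists z, {in W, forall l, omega l z = false} /\ omega v z.
Proof.
move=> [W0 WD].
have in_W (L : seq (pauli Q)) u : {subset L <= W} ->
    (forall z, {in L, forall l, omega l z = false} -> omega u z = false) ->
    u \in W.
  elim: L u => [|l L IH] u sLW u_perp.
    by rewrite (@omega_nondegenerate u) // => z; apply: u_perp.
  have sL : {subset L <= W} by move=> x xL; apply: sLW; rewrite inE xL orbT.
  have lW : l \in W by apply: sLW; rewrite mem_head.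
  case: (pickP (fun z => all (fun l => ~~ omega l z) L && omega u z)) => [z0|no_z].
    case/andP=> /allP z0L uz0.
    have lz0 : omega l z0.
      apply: contraTT uz0 => lz0; rewrite u_perp // => x.
      by rewrite inE => /predU1P[->|/z0L]; apply/negbTE.
    (* Both [u] and [l] pair to 1 with [z0], so [padd l u] is orthogonal to everything orthogonal to
       [L]: a [z] pairing to 1 with [l] is shifted by [z0], which makes it orthogonal to [l] as
       well. *)
    rewrite -(paddK l u) WD //; apply: IH => // z zL; rewrite omegaDl.
    case lz: (omega l z); last first.
      by rewrite u_perp // => x; rewrite inE => /predU1P[->|/zL].
    suff: omega u (padd z z0) = false by rewrite omegaDr uz0; case: omega.
    apply: u_perp => x; rewrite inE omegaDr => /predU1P[->|xL].
      by rewrite lz lz0.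
    by rewrite zL // (negbTE (z0L _ xL)).
  apply: IH => // z zL; apply: contraFF (no_z z) => ->; rewrite andbT.
  by apply/allP=> x /zL ->.
move=> vNW; have [z /andP[/forall_inP zW vz]|no_z] :=
  pickP (fun z => [forall (l | l \in W), ~~ omega l z] && omega v z).
  by exists z; split=> // l /zW/negbTE.
case/negP: vNW; apply: (in_W (enum W)) => [l|z zW]; first by rewrite mem_enum.
apply: contraFF (no_z z) => ->; rewrite andbT; apply/forall_inP=> l lW.
by rewrite zW ?mem_enum.
Qed.

Lemma perpP (S : {set pauli Q}) f :
  reflect {in S, forall g, omega f g = false} (f \in perp S).
Proof.
rewrite inE; apply: (iffP forall_inP) => fS g gS; first exact/negbTE/fS.
by rewrite fS.
Qed.

Lemma self_dual_closed (S : {set pauli Q}) : self_dual S -> padd_closed S.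
Proof.
move=> <-; split; first by apply/perpP=> g _; rewrite omega0l.
move=> f g /perpP fS /perpP gS; apply/perpP=> h hS.
by rewrite omegaDl fS ?gS.
Qed.

(** The kernel [K] of [phi] has index at most 2 in [S]. A vector orthogonal to [K] and pairing to 1
    with one element of [S] outside [K] therefore represents [phi] on all of [S]. *)
Lemma additive_omega (S : {set pauli Q}) (phi : pauli Q -> bool) :
  padd_closed S -> {in S &, forall f g, phi (padd f g) = phi f (+) phi g} ->
  exists h, {in S, forall f, phi f = omega f h}.
Proof.
move=> [S0 SD] phiD; pose K := [set f in S | ~~ phi f].
have phi0 : phi (pzero Q) = false by rewrite -(paddff (pzero Q)) phiD // addbb.
have K_closed : padd_closed K.
  split=> [|f g]; first by rewrite inE S0 phi0.
  by rewrite !inE => /andP[fS /negbTE f0] /andP[gS /negbTE g0]; rewrite SD ?phiD ?f0 ?g0.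
have [f0 /andP[f0S phif0]|phiN] := pickP (fun f => (f \in S) && phi f).
  have [|h [hK f0h]] := @perp_separation K f0 K_closed; first by rewrite inE phif0 andbF.
  exists h => f fS; case phif: (phi f); last by rewrite hK // inE fS phif.
  suff: omega (padd f f0) h = false by rewrite omegaDl f0h; case: omega.
  by rewrite hK // inE SD // phiD // phif phif0.
by exists (pzero Q) => f fS; have := phiN f; rewrite fS omega0r.
Qed.

(** * Symplectic transvections and Witt's theorem *)

Definition transvection h f := if omega f h then padd f h else f.

Definition transvections (hs : seq (pauli Q)) f := foldr transvection f hs.

Lemma transvectionD h f g :
  transvection h (padd f g) = padd (transvection h f) (transvection h g).
Proof.
rewrite /transvection omegaDl; case: omega; case: omega => //=.
- by rewrite -paddA (paddC h) -paddA paddff padd0.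
- by rewrite -!paddA (paddC g).
- by rewrite paddA.
Qed.

Lemma omega_transvection h f g :
  omega (transvection h f) (transvection h g) = omega f g.
Proof.
rewrite /transvection; case fh: (omega f h); case gh: (omega g h);
  by rewrite ?omegaDl ?omegaDr ?omegaff ?(omegaC h) ?fh ?gh ?addbF ?addbT ?addbb
             ?negbK.
Qed.

Lemma transvectionsD hs f g :
  transvections hs (padd f g) = padd (transvections hs f) (transvections hs g).
Proof. by elim: hs => //= h hs ->; rewrite transvectionD. Qed.

Lemma omega_transvections hs f g :
  omega (transvections hs f) (transvections hs g) = omega f g.
Proof. by elim: hs => //= h hs; rewrite omega_transvection. Qed.

(* One transvection suffices when [omega v w] is true; otherwise go through an
   intermediate vector pairing to 1 with both [v] and [w]. *)
Lemma transvections_move (W : {set pauli Q}) v w :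
  padd_closed W -> v \notin W -> w \notin W ->
  {in W, forall l, omega l v = omega l w} ->
  exists hs, transvections hs v = w /\ {in W, forall l, transvections hs l = l}.
Proof.
move=> W_closed vW wW eq_vw.
have one_step x y : omega x y -> {in W, forall l, omega l x = omega l y} ->
    transvection (padd x y) x = y /\ {in W, forall l, transvection (padd x y) l = l}.
  move=> xy eq_xy; rewrite /transvection omegaDr omegaff xy paddK; split=> // l lW.
  by rewrite omegaDr eq_xy // addbb.
case vw: (omega v w).
  by exists [:: padd v w]; apply: one_step.
have [z1 [z1W vz1]] := @perp_separation W v W_closed vW.
have [z2 [z2W wz2]] := @perp_separation W w W_closed wW.
have [z [zW [vz wz]]] : exists z, {in W, forall l, omega l z = false} /\
    omega v z /\ omega w z.
  case wz1: (omega w z1); first by exists z1.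
  case vz2: (omega v z2); first by exists z2.
  (* Here [z1] pairs to 1 with [v] only and [z2] with [w] only, so the sum pairs to 1 with both. *)
  exists (padd z1 z2); rewrite !omegaDr vz1 wz2 wz1 vz2; split=> // l lW.
  by rewrite omegaDr z1W ?z2W.
(* The intermediate vector is [padd v z]. It pairs with [W] as [v] does, because [z] is orthogonal
   to [W], and it pairs to 1 with [v] and with [w]. *)
have [|l lW|e1 f1] := one_step v (padd v z); first by rewrite omegaDr omegaff.
  by rewrite omegaDr zW // addbF.
have [|l lW|e2 f2] := one_step (padd v z) w.
- by rewrite omegaDl vw omegaC.
- by rewrite omegaDr zW // addbF eq_vw.
exists [:: padd (padd v z) w; padd v (padd v z)]; split=> /= [|l lW].
  by rewrite e1 e2.
by rewrite f1 ?f2.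
Qed.

(* Witt's theorem, for an isometry between subspaces given by its graph [R]. *)
Lemma witt_transvections (R : {set pauli Q * pauli Q}) :
  {in R &, forall p q, (padd p.1 q.1, padd p.2 q.2) \in R} ->
  {in R, forall p, p.1 = pzero Q <-> p.2 = pzero Q} ->
  {in R &, forall p q, omega p.1 q.1 = omega p.2 q.2} ->
  exists hs, {in R, forall p, transvections hs p.1 = p.2}.
Proof.
move=> RD R0 Romega.
(* [F hs] holds the pairs already matched by [hs]. Each round composes with transvections that fix
   the matched targets and match one more pair, so the number of unmatched pairs drops. *)
pose F hs := [set p in R | transvections hs p.1 == p.2].
suff step n hs : (#|R :\: F hs| <= n)%N ->
    exists hs, {in R, forall p, transvections hs p.1 = p.2}.
  exact: (step _ [::] (leqnn _)).
elim: n hs => [|n IH] hs.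
  rewrite leqn0 cards_eq0 setD_eq0 => /subsetP RF; exists hs => p /RF.
  by rewrite inE => /andP[_ /eqP].
move=> le_n; have [p|R_F] := pickP (mem (R :\: F hs)); last first.
  by apply: (IH hs); rewrite (eq_card0 R_F).
move=> /setDP[pR pF].
pose W := [set q.2 | q in F hs].
have W_closed : padd_closed W.
  have FD q r : q \in F hs -> r \in F hs -> (padd q.1 r.1, padd q.2 r.2) \in F hs.
    rewrite !inE => /andP[qR /eqP eq_q] /andP[rR /eqP eq_r].
    by rewrite RD //= transvectionsD eq_q eq_r eqxx.
  split=> [|_ _ /imsetP[q qF ->] /imsetP[r rF ->]]; last first.
    by apply/imsetP; exists (padd q.1 r.1, padd q.2 r.2) => //; apply: FD.
  apply/imsetP; exists (pzero Q, pzero Q) => //; rewrite inE /=.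
  rewrite -{1}(paddff p.1) -{1}(paddff p.2) RD //= -{1}(paddff p.1).
  by rewrite transvectionsD paddff.
(* If the current image of [p.1] or its target [p.2] lay in [W], then [p] would share a component
   with a matched pair. As components vanish together in [R], the two pairs would coincide and [p]
   would be matched. *)
have pNF q : q \in F hs -> ~ (transvections hs p.1 = q.2 \/ p.2 = q.2).
  rewrite inE => /andP[qR /eqP eq_q] eq_pq; case/negP: pF; rewrite inE pR /=.
  have [R0l R0r] := R0 _ (RD _ _ pR qR).
  case: eq_pq => eq_pq; apply/eqP.
    rewrite eq_pq; apply/esym/padd_eq0/R0l/omega_nondegenerate => x /=.
    by rewrite -(omega_transvections hs) transvectionsD eq_pq eq_q paddff omega0l.
  by rewrite (padd_eq0 (R0r _)) ?eq_q //= eq_pq paddff.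
have [||_ /imsetP[q qF ->]|hs' [hs'p hs'W]] :=
  @transvections_move W (transvections hs p.1) p.2 W_closed.
- by apply/imsetP=> -[q qF ?]; case: (pNF q qF); left.
- by apply/imsetP=> -[q qF ?]; case: (pNF q qF); right.
- move: qF; rewrite inE => /andP[qR /eqP eq_q].
  by rewrite -{1}eq_q omega_transvections Romega.
have cat_hs f : transvections (hs' ++ hs) f = transvections hs' (transvections hs f).
  by rewrite /transvections foldr_cat.
apply: (IH (hs' ++ hs)); rewrite -ltnS; apply: leq_trans le_n.
apply/proper_card/properP; split.
  apply: setDS; apply/subsetP=> q qF; have [qR /eqP eq_q] : q \in R /\ transvections hs q.1 == q.2.
    by move: qF; rewrite inE => /andP.
  by rewrite inE qR cat_hs eq_q hs'W //=; apply: imset_f.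
by exists p; rewrite inE ?pF // inE cat_hs hs'p pR eqxx.
Qed.

End SymplecticForm.

(** * Operators and Pauli matrices *)

Section Operators.
Variables (C : numClosedFieldType) (Q : finType).
Implicit Types (U V W : op C Q) (v : state C Q) (c : C).

Definition op_scale c U : op C Q := fun x y => c * U x y.
Definition op_add U V : op C Q := fun x y => U x y + V x y.

Lemma opP U V : (forall x y, U x y = V x y) -> U = V.
Proof. by move=> UV; do 2![apply: functional_extensionality => ?]. Qed.

Lemma op_mulA U V W : op_mul U (op_mul V W) = op_mul (op_mul U V) W.
Proof.
apply: opP => x y; rewrite /op_mul; under eq_bigr do rewrite mulr_sumr.
rewrite exchange_big; apply: eq_bigr => z _; rewrite mulr_suml.
by apply: eq_bigr => t _; rewrite mulrA.
Qed.

Lemma op_mul1l U : op_mul (@op_id C Q) U = U.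
Proof.
apply: opP => x y; rewrite /op_mul (bigD1 x) //= /op_id eqxx mul1r.
by rewrite big1 ?addr0 // => z /negPf; rewrite eq_sym => ->; rewrite mul0r.
Qed.

Lemma op_mul1r U : op_mul U (@op_id C Q) = U.
Proof.
apply: opP => x y; rewrite /op_mul (bigD1 y) //= /op_id eqxx mulr1.
by rewrite big1 ?addr0 // => z /negPf ->; rewrite mulr0.
Qed.

Lemma op_mulZl c U V : op_mul (op_scale c U) V = op_scale c (op_mul U V).
Proof.
by apply: opP => x y; rewrite /op_scale /op_mul mulr_sumr; apply: eq_bigr => z _; rewrite mulrA.
Qed.

Lemma op_mulZr c U V : op_mul U (op_scale c V) = op_scale c (op_mul U V).
Proof.
by apply: opP => x y; rewrite /op_scale /op_mul mulr_sumr; apply: eq_bigr => z _; rewrite mulrCA.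
Qed.

Lemma op_mulDl U V W : op_mul (op_add U V) W = op_add (op_mul U W) (op_mul V W).
Proof.
by apply: opP => x y; rewrite /op_add /op_mul -big_split; apply: eq_bigr => z _; rewrite mulrDl.
Qed.

Lemma op_mulDr U V W : op_mul W (op_add U V) = op_add (op_mul W U) (op_mul W V).
Proof.
by apply: opP => x y; rewrite /op_add /op_mul -big_split; apply: eq_bigr => z _; rewrite mulrDr.
Qed.

Lemma op_scaleA c d U : op_scale c (op_scale d U) = op_scale (c * d) U.
Proof. by apply: opP => x y; rewrite /op_scale mulrA. Qed.

Lemma op_scale1 U : op_scale 1 U = U.
Proof. by apply: opP => x y; rewrite /op_scale mul1r. Qed.

Lemma op_adjM U V : op_adj (op_mul U V) = op_mul (op_adj V) (op_adj U).
Proof.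
apply: opP => x y; rewrite /op_adj rmorph_sum; apply: eq_bigr => z _.
by rewrite rmorphM mulrC.
Qed.

Lemma op_adjK U : op_adj (op_adj U) = U.
Proof. by apply: opP => x y; rewrite /op_adj conjCK. Qed.

(** In finite dimension a one-sided inverse is two-sided. Operators are transported to square
    matrices to use this; it yields $U^\dagger U=1$ from the equation $UU^\dagger=1$ in
    [clifford]. *)
Lemma op_mul1C U V : op_mul U V = @op_id C Q -> op_mul V U = @op_id C Q.
Proof.
pose mx (W : op C Q) : 'M_#|cfg Q| := \matrix_(i, j) W (enum_val i) (enum_val j).
have mxM W1 W2 : mx W1 *m mx W2 = mx (op_mul W1 W2).
  apply/matrixP=> i j; rewrite !mxE /op_mul (reindex (@enum_val _ (cfg Q))) /=.
    by apply: eq_bigr => k _; rewrite !mxE.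
  exact/onW_bij/enum_val_bij.
have mx1 : mx (@op_id C Q) = 1%:M.
  by apply/matrixP=> i j; rewrite !mxE /op_id (inj_eq enum_val_inj).
move=> UV; have : mx (op_mul V U) = mx (@op_id C Q).
  by rewrite -mxM mx1; apply: mulmx1C; rewrite mxM UV.
move=> /matrixP eq_mx; apply: opP => x y.
by have := eq_mx (enum_rank x) (enum_rank y); rewrite !mxE !enum_rankK.
Qed.

Lemma op_appM U V v : op_app (op_mul U V) v = op_app U (op_app V v).
Proof.
apply: functional_extensionality => x.
rewrite /op_app; under eq_bigr do rewrite mulr_suml.
rewrite exchange_big; apply: eq_bigr => z _; rewrite mulr_sumr.
by apply: eq_bigr => t _; rewrite mulrA.
Qed.

Lemma op_app1 v : op_app (@op_id C Q) v = v.
Proof.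
apply: functional_extensionality => x; rewrite /op_app (bigD1 x) //= /op_id.
by rewrite eqxx mul1r big1 ?addr0 // => z /negPf; rewrite eq_sym => ->; rewrite mul0r.
Qed.

Lemma op_appZ c U v : op_app (op_scale c U) v = fun x => c * op_app U v x.
Proof.
apply: functional_extensionality => x; rewrite /op_app mulr_sumr.
by apply: eq_bigr => y _; rewrite /op_scale mulrA.
Qed.

Lemma op_app_scale c U v : op_app U (fun x => c * v x) = fun x => c * op_app U v x.
Proof.
apply: functional_extensionality => x; rewrite /op_app mulr_sumr.
by apply: eq_bigr => y _; rewrite mulrCA.
Qed.

Definition inner v w : C := \sum_x (v x)^* * w x.

Lemma inner_adj U v w : inner v (op_app U w) = inner (op_app (op_adj U) v) w.
Proof.
rewrite /inner /op_app; under eq_bigr do rewrite mulr_sumr.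
rewrite exchange_big; apply: eq_bigr => y _; rewrite rmorph_sum mulr_suml.
by apply: eq_bigr => x _; rewrite rmorphM /op_adj /= conjCK mulrCA mulrA.
Qed.

Lemma inner_scalel c v w : inner (fun x => c * v x) w = c^* * inner v w.
Proof. by rewrite mulr_sumr; apply: eq_bigr => x _; rewrite rmorphM mulrA. Qed.

Lemma inner_scaler c v w : inner v (fun x => c * w x) = c * inner v w.
Proof. by rewrite mulr_sumr; apply: eq_bigr => x _; rewrite mulrCA. Qed.

Lemma norm2E v : \sum_x `|v x| ^+ 2 = inner v v.
Proof. by apply: eq_bigr => x _; rewrite normCK mulrC. Qed.

End Operators.

(** * Pauli operators: products, phases and completeness *)

Section Paulis.
Variables (C : numClosedFieldType) (Q : finType).
Implicit Types (f g h : pauli Q).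
Local Notation sigma f := (sigma C f).

(* [pauli1 p * pauli1 q = pauli1_phase p q * pauli1 (p + q)] *)
Definition pauli1_phase (p q : bool * bool) : C :=
  match p, q with
  | (true, false), (false, true) | (false, true), (true, true)
  | (true, true), (true, false) => - 'i
  | (false, true), (true, false) | (true, true), (false, true)
  | (true, false), (true, true) => 'i
  | _, _ => 1
  end.

Lemma sum_pauli1_mul p q x y : \sum_z pauli1 C p x z * pauli1 C q z y =
  pauli1_phase p q * pauli1 C (p.1 (+) q.1, p.2 (+) q.2) x y.
Proof.
have ii : 'i * 'i = -1 :> C by rewrite -expr2 sqrCi.
rewrite big_bool; case: p q x y => [[] []] [[] []] [] [] /=;
  by rewrite ?(mulr0, mul0r, mulr1, mul1r, addr0, add0r, mulrN, mulNr, opprK, ii, oppr0).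
Qed.

Lemma pauli1_phaseC p q :
  pauli1_phase p q = (-1) ^+ ((p.1 && q.2) (+) (p.2 && q.1)) * pauli1_phase q p.
Proof. by case: p q => [[] []] [[] []] /=; rewrite ?expr1 ?expr0 ?mul1r ?mulN1r ?opprK. Qed.

Definition phase f g : C := \prod_q pauli1_phase (f q) (g q).

Lemma sigmaM f g : op_mul (sigma f) (sigma g) = op_scale (phase f g) (sigma (padd f g)).
Proof.
apply: opP => x y; rewrite /op_scale /phase -big_split /=.
transitivity (\prod_q \sum_z pauli1 C (f q) (x q) z * pauli1 C (g q) z (y q)).
  rewrite bigA_distr_bigA; apply: eq_bigr => z _; rewrite -big_split.
  by apply: eq_bigr.
by apply: eq_bigr => q _; rewrite sum_pauli1_mul ffunE.
Qed.

Lemma phaseC f g : phase f g = (-1) ^+ omega f g * phase g f.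
Proof.
rewrite /phase /omega (big_morph (fun b : bool => (-1) ^+ b : C) (id1 := 1) (op1 := *%R)) //.
  by rewrite -big_split; apply: eq_bigr => q _; rewrite pauli1_phaseC.
by move=> a b; rewrite signr_addb.
Qed.

Lemma phaseff f : phase f f = 1.
Proof. by rewrite /phase big1 // => q _; case: (f q) => [[] []]. Qed.

Lemma sigmaC f g :
  op_mul (sigma f) (sigma g) = op_scale ((-1) ^+ omega f g) (op_mul (sigma g) (sigma f)).
Proof. by rewrite !sigmaM op_scaleA -phaseC paddC. Qed.

Lemma prod_eqb (x y : cfg Q) : \prod_q ((x q == y q)%:R : C) = (x == y)%:R.
Proof.
have [->|xy] := eqVneq x y; first by rewrite big1 // => q _; rewrite eqxx.
have [q xyq] : exists q, x q != y q.
  apply/existsP; apply: contraR xy; rewrite negb_exists => /forallP eqxy.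
  by apply/eqP/ffunP=> q; apply/eqP; have := eqxy q; rewrite negbK.
by rewrite (bigD1 q) //= (negbTE xyq) mul0r.
Qed.

Lemma sigma0 : sigma (pzero Q) = @op_id C Q.
Proof. by apply: opP => x y; rewrite /op_id -prod_eqb; apply: eq_bigr => q _; rewrite ffunE. Qed.

Lemma sigmaK f : op_mul (sigma f) (sigma f) = @op_id C Q.
Proof. by rewrite sigmaM phaseff op_scale1 paddff sigma0. Qed.

Lemma sigma_adj f : op_adj (sigma f) = sigma f.
Proof.
apply: opP => x y; rewrite /op_adj rmorph_prod; apply: eq_bigr => q _.
case: (f q) (x q) (y q) => [[] []] [] [] //=;
  by rewrite ?rmorph0 ?rmorph1 ?rmorphN1 // ?rmorphN /= conjCi ?opprK.
Qed.

Lemma op_scale_id_inj c d : op_scale c (@op_id C Q) = op_scale d (@op_id C Q) -> c = d.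
Proof.
move=> /(congr1 (fun U : op C Q => U [ffun=> false] [ffun=> false])).
by rewrite /op_scale /op_id eqxx !mulr1.
Qed.

(** Paulis are invertible, so the sign in a commutation relation is unique. This allows [omega] to
    be read off from operator identities. *)
Lemma sigma_comm_sign (b : bool) f g :
  op_mul (sigma f) (sigma g) = op_scale ((-1) ^+ b) (op_mul (sigma g) (sigma f)) ->
  b = omega f g.
Proof.
have gffg : op_mul (op_mul (sigma g) (sigma f)) (op_mul (sigma f) (sigma g)) = @op_id C Q.
  by rewrite -op_mulA (op_mulA (sigma f)) sigmaK op_mul1l sigmaK.
rewrite sigmaC => /(congr1 (fun U => op_mul U (op_mul (sigma f) (sigma g)))).
by rewrite !op_mulZl gffg => /op_scale_id_inj /signr_inj.
Qed.

(** By anticommutation $\sigma(f)\sigma(g)$ squares to $-1$, while [sigma (padd f g)] squares to 1.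
    Hence the phase is $\pm i$. *)
Lemma phase_anticomm f g : omega f g ->
  exists s : bool, 'i * phase f g = (-1) ^+ s.
Proof.
move=> fg; have : (phase f g) ^+ 2 = -1.
  apply: (@op_scale_id_inj).
  rewrite expr2 -op_scaleA -(sigmaK (padd f g)) -op_mulZl -op_mulZr -sigmaM.
  rewrite {2}sigmaC fg expr1 op_mulZr.
  by rewrite -op_mulA (op_mulA (sigma g)) sigmaK op_mul1l sigmaK sigmaK.
move=> sq; have : ('i * phase f g) ^+ 2 == 1 by rewrite exprMn sqrCi sq mulrNN mulr1.
by rewrite sqrf_eq1 => /orP[]/eqP ->; [exists false | exists true].
Qed.

(** In operator form this is $\sum_p \sigma_p\otimes\sigma_p = 2\,\mathrm{SWAP}$ on two qubits. Its
    many-qubit version serves to expand operators in the Pauli basis. *)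
Lemma sum_pauli1_complete x y z w :
  \sum_p pauli1 C p x y * pauli1 C p z w = 2 * ((x == w) && (y == z))%:R.
Proof.
have ii : 'i * 'i = -1 :> C by rewrite -expr2 sqrCi.
transitivity (\sum_a \sum_b pauli1 C (a, b) x y * pauli1 C (a, b) z w).
  by rewrite pair_bigA; apply: eq_bigr => -[].
rewrite !big_bool /=; case: x y z w => [] [] [] [] /=;
rewrite ?(mulr0, mul0r, mulr1, mul1r, addr0, add0r, mulrN, mulNr, opprK, ii, oppr0) //;
by rewrite ?subrr ?addNr.
Qed.

Lemma sum_sigma_complete (x y z w : cfg Q) :
  \sum_(f : pauli Q) sigma f x y * sigma f z w = 2 ^+ #|Q| * ((x == w)%:R * (y == z)%:R).
Proof.
transitivity (\prod_q \sum_p pauli1 C p (x q) (y q) * pauli1 C p (z q) (w q)).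
  rewrite bigA_distr_bigA; apply: eq_bigr => f _.
  by rewrite -big_split.
under eq_bigr do rewrite sum_pauli1_complete -mulnb natrM.
by rewrite !big_split /= !prod_eqb prodr_const.
Qed.

End Paulis.

(** * Clifford operators and stabilizer states *)

Section Clifford.
Variables (C : numClosedFieldType) (Q : finType).
Implicit Types (f g h : pauli Q) (U V : op C Q) (u : pauli Q -> pauli Q) (v : state C Q).
Local Notation sigma f := (sigma C f).

(** The label map is a parameter here, so that maps of different Cliffords can be composed and
    compared. *)
Definition clifford_over U u :=
  op_mul U (op_adj U) = @op_id C Q /\
  forall f, exists s : bool, op_mul (op_mul U (sigma f)) (op_adj U)
                             = op_scale ((-1) ^+ s) (sigma (u f)).

Lemma cliffordP U : clifford U <-> exists u, clifford_over U u.
Proof.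
split=> [[U1 [u uP]]|[u [U1 uP]]].
  exists u; split=> [|f]; first exact: opP.
  by have [s sP] := uP f; exists s; apply: opP.
split=> [x y|]; first by rewrite U1.
by exists u => f; have [s sP] := uP f; exists s => x y; rewrite sP.
Qed.

Lemma clifford_adjl U u : clifford_over U u -> op_mul (op_adj U) U = @op_id C Q.
Proof. by case=> /op_mul1C. Qed.

Lemma clifford_intertwine U u f : clifford_over U u -> exists s : bool,
  op_mul U (sigma f) = op_scale ((-1) ^+ s) (op_mul (sigma (u f)) U).
Proof.
move=> Uu; have [s sP] := Uu.2 f; exists s.
by rewrite -op_mulZl -sP -!op_mulA (clifford_adjl Uu) op_mul1r.
Qed.

Lemma clifford_mul U V u w :
  clifford_over U u -> clifford_over V w -> clifford_over (op_mul U V) (u \o w).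
Proof.
move=> Uu Vw; split=> [|f].
  by rewrite op_adjM -op_mulA (op_mulA V) Vw.1 op_mul1l Uu.1.
have [s sP] := Vw.2 f; have [t tP] := Uu.2 (w f); exists (s (+) t).
rewrite op_adjM (op_mulA _ (op_adj V)) -(op_mulA U) -(op_mulA U) sP.
by rewrite op_mulZr op_mulZl tP op_scaleA signr_addb.
Qed.

Lemma clifford_id : clifford_over (@op_id C Q) id.
Proof.
have adj1 : op_adj (@op_id C Q) = @op_id C Q.
  by apply: opP => x y; rewrite /op_adj /op_id rmorph_nat eq_sym.
split=> [|f]; first by rewrite adj1 op_mul1l.
by exists false; rewrite adj1 op_mul1l op_mul1r expr0 op_scale1.
Qed.

Lemma clifford_sigma h : clifford_over (sigma h) id.
Proof.
split=> [|f]; first by rewrite sigma_adj sigmaK.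
exists (omega h f); rewrite sigma_adj sigmaC op_mulZl -op_mulA sigmaK.
by rewrite op_mul1r.
Qed.

(** Since $\sigma(h)^2=1$, this is $\exp(i\pi\sigma(h)/4)$. *)
Definition transvection_op h : op C Q :=
  op_scale (sqrtC 2)^-1 (op_add (@op_id C Q) (op_scale 'i (sigma h))).

Lemma transvection_op_adj h : op_adj (transvection_op h) =
  op_scale (sqrtC 2)^-1 (op_add (@op_id C Q) (op_scale (- 'i) (sigma h))).
Proof.
apply: opP => x y; rewrite /op_adj /transvection_op /op_scale /op_add.
rewrite rmorphM rmorphD rmorphM /= conjCi /op_id rmorph_nat eq_sym.
have -> : (sigma h y x)^* = sigma h x y by rewrite -[in RHS]sigma_adj.
by rewrite conj_Creal // ger0_real // invr_ge0 sqrtC_ge0 ler0n.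
Qed.

(** Write $U$ for the operator. If [sigma f] commutes with [sigma h], it commutes with $U$.
    Otherwise $\sigma(f)U^\dagger=U\sigma(f)$, so the conjugate is
    $U^2\sigma(f)=i\sigma(h)\sigma(f)$, a sign times [sigma (padd f h)]. *)
Lemma clifford_transvection h : clifford_over (transvection_op h) (transvection h).
Proof.
have half2 : (sqrtC 2)^-1 * (sqrtC 2)^-1 + (sqrtC 2)^-1 * (sqrtC 2)^-1 = 1 :> C.
  by rewrite -invfM -expr2 sqrtCK -[2^-1]mul1r -splitr.
have unitary : op_mul (transvection_op h) (op_adj (transvection_op h)) = @op_id C Q.
  rewrite transvection_op_adj op_mulZl op_mulZr op_scaleA op_mulDl !op_mulDr.
  rewrite !op_mulZl !op_mulZr !op_mul1l op_mul1r sigmaK; apply: opP => x y.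
  rewrite /op_scale /op_add (mulrA 'i) mulrN -(expr2 ('i : C)) sqrCi opprK mul1r mulNr addrA subrK.
  by rewrite mulrDr -mulrDl half2 mul1r.
split=> // f; rewrite /transvection; case fh: (omega f h); last first.
  exists false; rewrite expr0 op_scale1.
  suff -> : op_mul (transvection_op h) (sigma f) = op_mul (sigma f) (transvection_op h).
    by rewrite -op_mulA unitary op_mul1r.
  rewrite /transvection_op op_mulZl op_mulZr op_mulDl op_mulDr op_mul1l op_mul1r.
  by rewrite op_mulZl op_mulZr (sigmaC C f) fh op_scale1.
have [|s sP] := @phase_anticomm C Q h f; first by rewrite omegaC.
have anticomm : op_mul (sigma f) (op_adj (transvection_op h))
                = op_mul (transvection_op h) (sigma f).
  rewrite transvection_op_adj !op_mulZr op_mulZl op_mulDl op_mulDr op_mulZr op_mulZl.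
  rewrite op_mul1l op_mul1r (sigmaC C f) fh expr1; congr op_scale; apply: opP => x y.
  by rewrite /op_add /op_scale mulN1r mulrNN.
have square : op_mul (transvection_op h) (transvection_op h) = op_scale 'i (sigma h).
  rewrite op_mulZl op_mulZr op_scaleA op_mulDl !op_mulDr !op_mulZl !op_mulZr.
  rewrite !op_mul1l op_mul1r sigmaK; apply: opP => x y.
  rewrite /op_scale /op_add (mulrA 'i) -(expr2 ('i : C)) sqrCi mulN1r.
  rewrite (addrC (op_id C x y)) addrACA subrr addr0.
  by rewrite mulrDr -mulrDl half2 mul1r.
exists s; rewrite -op_mulA anticomm op_mulA square op_mulZl sigmaM op_scaleA sP.
by rewrite paddC.
Qed.

Lemma clifford_transvections hs :
  clifford_over (foldr (fun h => op_mul (transvection_op h)) (@op_id C Q) hs)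
                (transvections hs).
Proof.
elim: hs => [|h hs IH] /=; first exact: clifford_id.
exact: clifford_mul (clifford_transvection h) IH.
Qed.

(** Conjugation preserves commutation relations, and the signs attached to [u f] and [u g] occur
    alike in both orders of the product, so they cancel. *)
Lemma clifford_omega U u f g : clifford_over U u -> omega (u f) (u g) = omega f g.
Proof.
move=> Uu; apply/esym/(@sigma_comm_sign C).
have [s sP] := clifford_intertwine f Uu; have [t tP] := clifford_intertwine g Uu.
have push f' g' s' t' :
    op_mul U (sigma f') = op_scale ((-1) ^+ s') (op_mul (sigma (u f')) U) ->
    op_mul U (sigma g') = op_scale ((-1) ^+ t') (op_mul (sigma (u g')) U) ->
    op_mul (sigma (u f')) (sigma (u g')) = op_scale ((-1) ^+ (s' + t'))
      (op_mul (op_mul U (op_mul (sigma f') (sigma g'))) (op_adj U)).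
  move=> ef eg; rewrite op_mulA ef op_mulZl -(op_mulA _ U) eg op_mulZr.
  rewrite !op_mulZl op_scaleA -!op_mulA Uu.1 op_mul1r !op_scaleA -!exprD.
  by rewrite -addnA addnn -signr_odd odd_double op_scale1.
rewrite (push _ _ _ _ sP tP) (push _ _ _ _ tP sP) sigmaC op_mulZr op_mulZl !op_scaleA.
by rewrite mulrC addnC.
Qed.

Lemma clifford_inj U u : clifford_over U u -> injective u.
Proof.
move=> Uu f g eq_u; apply/padd_eq0/omega_nondegenerate => z.
by rewrite omegaDl -(clifford_omega f z Uu) -(clifford_omega g z Uu) eq_u addbb.
Qed.

(** Being injective on a finite set, [u] is onto. Additivity can then be tested by pairing with
    vectors in its image, where [omega] is preserved. *)
Lemma cliffordD U u f g : clifford_over U u -> u (padd f g) = padd (u f) (u g).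
Proof.
move=> Uu; apply/padd_eq0/omega_nondegenerate => z.
have [u' _ uK] := injF_bij (clifford_inj Uu).
by rewrite -(uK z) !omegaDl !(clifford_omega _ _ Uu) omegaDl addbb.
Qed.

End Clifford.

(** * Stabilizer states: maximality and uniqueness *)

Section StabilizerStates.
Variables (C : numClosedFieldType) (Q : finType).
Implicit Types (f g h : pauli Q) (S : {set pauli Q}) (v : state C Q).
Local Notation sigma f := (sigma C f).

Definition stabilizes f (s : bool) v := op_app (sigma f) v = fun x => (-1) ^+ s * v x.

Lemma stab_stateP S v : is_stab_state S v <->
  [/\ self_dual S, inner v v = 1 & exists eps, {in S, forall f, stabilizes f (eps f) v}].
Proof.
split=> -[Sd v1 [eps epsP]]; split=> //.
- by rewrite -norm2E.
- by exists eps => f fS; apply: functional_extensionality; apply: epsP.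
- by rewrite norm2E.
- by exists eps => f fS x; rewrite epsP.
Qed.

(** Both orders of application multiply [v] by the same sign, while anticommutation would make the
    two results opposite and force [inner v v] to vanish. *)
Lemma stabilizes_omega f g s t v :
  stabilizes f s v -> stabilizes g t v -> inner v v = 1 -> omega f g = false.
Proof.
move=> fv gv v1; case fg: (omega f g) => //.
have : op_app (op_mul (sigma f) (sigma g)) v
       = (fun x => (-1) ^+ true * op_app (op_mul (sigma g) (sigma f)) v x).
  by rewrite sigmaC fg op_appZ.
rewrite !op_appM fv gv !op_app_scale fv gv => /(congr1 (inner v)).
rewrite !inner_scaler v1 !mulr1 expr1 mulN1r (mulrC (_ ^+ t)) -signr_addb.
move/eqP; rewrite -subr_eq0 opprK -mulr2n mulrn_eq0 /=.
by rewrite signr_eq0.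
Qed.

(** A Pauli with [v] as eigenvector commutes with all of [S], hence lies in [perp S], which is
    [S]. *)
Lemma stab_state_mem S v f s : is_stab_state S v -> stabilizes f s v -> f \in S.
Proof.
move=> /stab_stateP[Sd v1 [eps epsP]] fv; rewrite -Sd; apply/perpP=> g gS.
exact: (stabilizes_omega fv (epsP _ gS)).
Qed.

Lemma stabilizesM f g s t v : stabilizes f s v -> stabilizes g t v ->
  (fun x => phase C f g * op_app (sigma (padd f g)) v x) = (fun x => (-1) ^+ (s (+) t) * v x).
Proof.
move=> fv gv; rewrite -op_appZ -sigmaM op_appM gv op_app_scale fv.
by apply: functional_extensionality => x; rewrite mulrA -signr_addb addbC.
Qed.

(** For [g] in [S] the same sign comes out of both matrix elements. For [g] outside, self-duality
    gives some [f] in [S] anticommuting with [g], and moving [sigma f] across shows that both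
    elements are zero. *)
Lemma inner_sigma S eps v w g : self_dual S -> inner v v = 1 ->
  {in S, forall f, stabilizes f (eps f) v} -> {in S, forall f, stabilizes f (eps f) w} ->
  inner v (op_app (sigma g) w) = inner v w * inner v (op_app (sigma g) v).
Proof.
move=> Sd v1 vS wS; have [gS|] := boolP (g \in S).
  by rewrite (vS g gS) (wS g gS) !inner_scaler v1 mulr1 mulrC.
rewrite -Sd inE negb_forall_in => /exists_inP[f fS]; rewrite negbK => gf.
suff zero x : {in S, forall f, stabilizes f (eps f) x} ->
    inner v (op_app (sigma g) x) = 0 by rewrite !zero ?mulr0.
move=> xS; have e : inner v (op_app (sigma g) (op_app (sigma f) x))
    = - inner v (op_app (sigma f) (op_app (sigma g) x)).
  by rewrite -!op_appM sigmaC gf op_appZ inner_scaler expr1 mulN1r.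
move: e; rewrite (xS f fS) op_app_scale inner_scaler (inner_adj (sigma f)) sigma_adj.
rewrite (vS f fS) inner_scalel rmorph_sign => /eqP.
by rewrite -subr_eq0 opprK -mulr2n mulrn_eq0 /= mulf_eq0 signr_eq0 => /eqP.
Qed.

(** The operator $|w\rangle\langle v|$ is expanded in the Pauli basis. By [inner_sigma] its
    coefficients are [inner v w] times those of $|v\rangle\langle v|$, so the operators are
    proportional, and applying both to [v] gives the claim. *)
Lemma stab_state_unique S eps v w : self_dual S -> inner v v = 1 ->
  {in S, forall f, stabilizes f (eps f) v} -> {in S, forall f, stabilizes f (eps f) w} ->
  w = fun x => inner v w * v x.
Proof.
move=> Sd v1 vS wS.
have expand w' x y : 2 ^+ #|Q| * (w' x * (v y)^*) =
    \sum_(g : pauli Q) sigma g x y * inner v (op_app (sigma g) w').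
  transitivity (\sum_z \sum_t ((v z)^* * w' t) * \sum_(g : pauli Q) sigma g x y * sigma g z t).
    under eq_bigr do under eq_bigr do rewrite sum_sigma_complete.
    rewrite (bigD1 y) //= (bigD1 x) //= !eqxx !mulr1 big1 => [|t /negPf xt].
      rewrite big1 => [|z /negPf yz]; first by rewrite !addr0 mulrC (mulrC (w' x)).
      by rewrite big1 // => t _; rewrite (eq_sym y) yz !mulr0.
    by rewrite (eq_sym x) xt !(mul0r, mulr0).
  under eq_bigr do under eq_bigr do rewrite mulr_sumr.
  under eq_bigr do rewrite exchange_big.
  rewrite exchange_big; apply: eq_bigr => g _; rewrite mulr_sumr.
  apply: eq_bigr => z _; rewrite !mulr_sumr; apply: eq_bigr => t _.
  by rewrite mulrCA -[_ * _ * sigma g z t]mulrA (mulrC (w' t)).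
have prop_xy x y : w x * (v y)^* = inner v w * v x * (v y)^*.
  have two_neq0 : 2 ^+ #|Q| != 0 :> C by rewrite expf_neq0 // pnatr_eq0.
  apply: (mulfI two_neq0); rewrite -mulrA (mulrCA _ (inner v w)) !expand mulr_sumr.
  by apply: eq_bigr => g _; rewrite (inner_sigma _ Sd v1 vS wS) mulrCA.
apply: functional_extensionality => x.
rewrite -[LHS]mulr1 -v1 mulr_sumr -[RHS]mulr1 -[in RHS]v1 mulr_sumr.
by apply: eq_bigr => y _; rewrite !mulrA prop_xy.
Qed.

End StabilizerStates.

(** * Local operators and splittings of the qubits *)

(** Parties may hold different numbers of qubits, so the range of summation depends on the factor.
    Choices are first made in the common tagged type and then turned into elements of [fprod]. *)
Lemma bigA_distr_fprod (R : nzSemiRingType) (I : finType) (T : I -> finType)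
    (F : forall i, T i -> R) :
  \prod_i \sum_(j : T i) F i j = \sum_(t : fprod T) \prod_i F i (t i).
Proof.
under eq_bigr do rewrite big_tag.
rewrite bigA_distr_big_dep.
rewrite (eq_bigr (fun g : {ffun I -> {i : I & T i}} => \prod_i untag 0 [ffun j => F i j] (g i))); last first.
  move=> g _; apply: eq_bigr => i _; rewrite /untag; case: eqP => // e.
  by rewrite ffunE.
rewrite -(big_fprod 1 +%R (fun i => [ffun j => F i j])); apply: eq_bigr => t _.
by apply: eq_bigr => i _; rewrite ffunE.
Qed.

Section Parties.
Variables (C : numClosedFieldType) (M Q : finType) (own : Q -> M).
Local Notation party := (party_qubits own).

Lemma big_parties (R : Type) (idx : R) (op : Monoid.com_law idx) (F : Q -> R) :
  \big[op/idx]_q F q = \big[op/idx]_a \big[op/idx]_(q : party a) F (val q).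
Proof.
rewrite (partition_big own xpredT) //; apply: eq_bigr => a _ /=.
exact: (big_sub [pred q | own q == a]).
Qed.

Lemma omega_restr a f g : omega (restr_pauli own a f) (restr_pauli own a g) =
  \big[addb/false]_(q | own q == a)
    (((f q).1 && (g q).2) (+) ((f q).2 && (g q).1)).
Proof.
rewrite (big_sub [pred q | own q == a]).
by apply: eq_bigr => q _; rewrite !ffunE.
Qed.

Lemma restr_pauli_eq0P a (f : pauli Q) :
  restr_pauli own a f = pzero _ <-> forall q, own q = a -> f q = (false, false).
Proof.
split=> [f0 q /eqP qa|f0]; last first.
  by apply/ffunP=> q; rewrite !ffunE f0 //; apply/eqP/(valP q).
by have /ffunP/(_ (Sub q qa)) := f0; rewrite !ffunE.
Qed.

Lemma restr_pauliD a f g :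
  restr_pauli own a (padd f g) = padd (restr_pauli own a f) (restr_pauli own a g).
Proof. by apply/ffunP=> q; rewrite !ffunE. Qed.

(** This inverts restriction to the parties: each qubit reads the component of its own owner. *)
Definition glue (A : Type) (F : forall a, {ffun party a -> A}) : {ffun Q -> A} :=
  [ffun q => F (own q) (Sub q (eqxx (own q)))].

Lemma glueE (A : Type) (F : forall a, {ffun party a -> A}) a (q : party a) :
  glue F (val q) = F a q.
Proof.
case: q => q qa; rewrite ffunE /=; have e := eqP qa; subst a.
by congr (F _ _); apply: val_inj.
Qed.

Lemma restr_glue F a : restr_pauli own a (glue F) = F a.
Proof. by apply/ffunP=> q; rewrite ffunE glueE. Qed.

Lemma sigma_local f : local_op (fun a => sigma C (restr_pauli own a f)) = sigma C f.
Proof.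
apply: opP => x y; rewrite /sigma big_parties; apply: eq_bigr => a _.
by apply: eq_bigr => q _; rewrite !ffunE.
Qed.

Implicit Types U V : forall a, op C (party a).

Lemma eq_local_op U V : (forall a, U a = V a) -> local_op U = local_op V.
Proof. by move=> UV; apply: opP => x y; apply: eq_bigr => a _; rewrite UV. Qed.

Lemma local_op_id : local_op (fun a => @op_id C (party a)) = @op_id C Q.
Proof.
rewrite -sigma0 -sigma_local; apply: eq_local_op => a; rewrite -sigma0.
by congr sigma; apply/ffunP=> q; rewrite !ffunE.
Qed.

Lemma local_op_adj U : op_adj (local_op U) = local_op (fun a => op_adj (U a)).
Proof. by apply: opP => x y; rewrite /op_adj rmorph_prod. Qed.

Lemma local_opZ (c : M -> C) U :
  local_op (fun a => op_scale (c a) (U a)) = op_scale (\prod_a c a) (local_op U).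
Proof. by apply: opP => x y; rewrite /op_scale -big_split. Qed.

(** Restriction and [glue] identify global configurations with families of party configurations, so
    a product over parties of sums becomes one global sum. *)
Lemma local_op_mul U V :
  op_mul (local_op U) (local_op V) = local_op (fun a => op_mul (U a) (V a)).
Proof.
apply: opP => x y; rewrite [RHS]bigA_distr_fprod.
pose h (z : cfg Q) : fprod (fun a => cfg (party a)) := [fprod a => restr_cfg own a z].
pose h' (t : fprod (fun a => cfg (party a))) : cfg Q := glue (fun a => t a).
rewrite (reindex h) /=; last first.
  exists h' => [z|t] _; first by apply/ffunP=> q; rewrite ffunE fprodE ffunE.
  by apply/fprodP=> a; rewrite fprodE; apply/ffunP=> q; rewrite ffunE glueE.
apply: eq_bigr => z _; rewrite -big_split; apply: eq_bigr => a _.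
by rewrite /h fprodE.
Qed.

Definition local_map (u : forall a, pauli (party a) -> pauli (party a)) (f : pauli Q) :=
  glue (fun a => u a (restr_pauli own a f)).

Lemma clifford_local U u :
  (forall a, clifford_over (U a) (u a)) -> clifford_over (local_op U) (local_map u).
Proof.
move=> Uu; split=> [|f].
  rewrite local_op_adj local_op_mul -local_op_id; apply: eq_local_op => a.
  exact: (Uu a).1.
have [s sP] := fin_all_exists (fun a => (Uu a).2 (restr_pauli own a f)).
(* The global sign is the product of the party signs, that is, the parity of their exponents. *)
exists (\big[addb/false]_a s a).
rewrite local_op_adj -(sigma_local f) -(sigma_local (local_map u f)) !local_op_mul.
rewrite (big_morph (fun b : bool => (-1) ^+ b : C) (id1 := 1) (op1 := *%R)) //.
  by rewrite -local_opZ; apply: eq_local_op => a; rewrite sP restr_glue.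
by move=> a b; rewrite signr_addb.
Qed.

End Parties.

(** * Splitting the qubits into two subsystems *)

Section Splitting.
Variables (C : numClosedFieldType) (M Q1 Q2 Q : finType).
Variables (pi : Q1 + Q2 -> Q) (pi' : Q -> Q1 + Q2).
Hypotheses (piK : cancel pi pi') (pi'K : cancel pi' pi).

(** Polymorphism in [A] covers configurations and Pauli labels alike. On labels it is the tensor
    product of Paulis, with [pzero] as identity factor. *)
Definition join (A : Type) (x : {ffun Q1 -> A}) (y : {ffun Q2 -> A}) : {ffun Q -> A} :=
  [ffun q => match pi' q with inl q1 => x q1 | inr q2 => y q2 end].

Definition joinl (A : Type) (z : {ffun Q -> A}) : {ffun Q1 -> A} := [ffun q => z (pi (inl q))].
Definition joinr (A : Type) (z : {ffun Q -> A}) : {ffun Q2 -> A} := [ffun q => z (pi (inr q))].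

Lemma joinlK A x y : joinl (@join A x y) = x.
Proof. by apply/ffunP=> q; rewrite !ffunE piK. Qed.

Lemma joinrK A x y : joinr (@join A x y) = y.
Proof. by apply/ffunP=> q; rewrite !ffunE piK. Qed.

Lemma joinK A (z : {ffun Q -> A}) : join (joinl z) (joinr z) = z.
Proof. by apply/ffunP=> q; rewrite ffunE; case e: (pi' q); rewrite ffunE -e pi'K. Qed.

Lemma big_split_qubits (R : Type) (idx : R) (op : Monoid.com_law idx) (P : pred Q) F :
  \big[op/idx]_(q | P q) F q =
  op (\big[op/idx]_(q | P (pi (inl q))) F (pi (inl q)))
     (\big[op/idx]_(q | P (pi (inr q))) F (pi (inr q))).
Proof.
rewrite (reindex pi); first by rewrite big_sumType.
by exists pi' => q _; rewrite (piK, pi'K).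
Qed.

Lemma sum_join (F : cfg Q -> C) : \sum_z F z = \sum_x \sum_y F (join x y).
Proof.
rewrite pair_bigA (reindex (fun p : cfg Q1 * cfg Q2 => join p.1 p.2)) //=.
exists (fun z => (joinl z, joinr z)) => [[x y]|z] _ /=; first by rewrite joinlK joinrK.
exact: joinK.
Qed.

Lemma padd_join f g f' g' :
  padd (join f g) (join f' g') = join (padd f f') (padd g g') :> pauli Q.
Proof. by apply/ffunP=> q; rewrite !ffunE; case: (pi' q) => r; rewrite ffunE. Qed.

Lemma omega_join f g f' g' :
  omega (join f g) (join f' g') = omega f f' (+) omega g g'.
Proof.
rewrite /omega big_split_qubits.
by congr addb; apply: eq_bigr => q _; rewrite !ffunE piK.
Qed.

Lemma sigma_join f g x y x' y' :
  sigma C (join f g) (join x y) (join x' y') = sigma C f x x' * sigma C g y y'.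
Proof.
rewrite /sigma big_split_qubits.
by congr *%R; apply: eq_bigr => q _; rewrite !ffunE piK.
Qed.

Lemma op_app_joinl f (v : state C Q) x y :
  op_app (sigma C (join f (pzero Q2))) v (join x y) =
  op_app (sigma C f) (fun x' => v (join x' y)) x.
Proof.
rewrite /op_app sum_join; apply: eq_bigr => x' _.
under eq_bigr do rewrite sigma_join sigma0.
rewrite (bigD1 y) //= /op_id eqxx mulr1 big1 ?addr0 // => y' /negPf.
by rewrite eq_sym => ->; rewrite mulr0 mul0r.
Qed.

Lemma op_app_joinr g (v : state C Q) x y :
  op_app (sigma C (join (pzero Q1) g)) v (join x y) =
  op_app (sigma C g) (fun y' => v (join x y')) y.
Proof.
rewrite /op_app sum_join exchange_big; apply: eq_bigr => y' _.
under eq_bigr do rewrite sigma_join sigma0.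
rewrite (bigD1 x) //= /op_id eqxx mul1r big1 ?addr0 // => x' /negPf.
by rewrite eq_sym => ->; rewrite !mul0r.
Qed.

Lemma relabel_tensorE (v : state C Q1) (w : state C Q2) x y :
  relabel pi (tensor_state v w) (join x y) = v x * w y.
Proof.
by congr (v _ * w _); apply/ffunP=> q; rewrite !ffunE piK.
Qed.

Lemma eq_state_join (v w : state C Q) :
  (forall x y, v (join x y) = w (join x y)) -> v = w.
Proof. by move=> vw; apply: functional_extensionality => z; rewrite -(joinK z). Qed.

Variables (own : Q -> M) (own1 : Q1 -> M) (own2 : Q2 -> M).
Hypothesis own_pi : forall r, own (pi r) = sum_owner own1 own2 r.

Lemma omega_restr_joinl a f g :
  omega (restr_pauli own a (join f (pzero Q2))) (restr_pauli own a (join g (pzero Q2)))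
  = omega (restr_pauli own1 a f) (restr_pauli own1 a g).
Proof.
rewrite !omega_restr big_split_qubits -[RHS]addbF; congr addb.
  by apply: eq_big => q; rewrite ?own_pi // !ffunE piK.
by apply: big1 => q _; rewrite !ffunE piK ffunE.
Qed.

Lemma restr_joinl_eq0 a f :
  restr_pauli own a (join f (pzero Q2)) = pzero _ <-> restr_pauli own1 a f = pzero _.
Proof.
split=> /restr_pauli_eq0P f0; apply/restr_pauli_eq0P => q qa.
  by have := f0 (pi (inl q)); rewrite ffunE piK; apply; rewrite own_pi.
rewrite ffunE; case e: (pi' q) => [r|r]; last by rewrite ffunE.
by apply: f0; rewrite -qa -(pi'K q) own_pi e.
Qed.

End Splitting.

(** * Extractability *)

Section StabilizedStates.
Variables (C : numClosedFieldType) (Q : finType).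
Implicit Types (f g h : pauli Q) (U : op C Q) (v : state C Q).
Local Notation sigma f := (sigma C f).

Lemma inner1_neq0 v : inner v v = 1 -> exists x, v x != 0.
Proof.
move=> v1; apply/existsP; apply: contra_eqT v1; rewrite negb_exists => /forallP v0.
rewrite /inner big1 ?(eq_sym 0) ?oner_neq0 // => x _.
by have := v0 x; rewrite negbK => /eqP ->; rewrite mulr0.
Qed.

Lemma inner_unitary U v : op_mul (op_adj U) U = @op_id C Q ->
  inner (op_app U v) (op_app U v) = inner v v.
Proof. by move=> U1; rewrite inner_adj -op_appM U1 op_app1. Qed.

Lemma stabilizes_scale c f s v : stabilizes f s v -> stabilizes f s (fun x => c * v x).
Proof.
move=> fv; rewrite /stabilizes op_app_scale fv.
by apply: functional_extensionality => x; rewrite mulrCA.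
Qed.

Lemma stabilizes_clifford U u f s v : clifford_over U u -> stabilizes f s v ->
  exists t, stabilizes (u f) t (op_app U v).
Proof.
move=> Uu fv; have [r rP] := clifford_intertwine f Uu; exists (r (+) s); rewrite /stabilizes.
have -> : op_app (sigma (u f)) (op_app U v)
        = op_app (op_scale ((-1) ^+ r) (op_mul U (sigma f))) v.
  by rewrite rP op_scaleA -expr2 sqrr_sign op_scale1 op_appM.
rewrite op_appZ op_appM fv op_app_scale.
by apply: functional_extensionality => x; rewrite mulrA signr_addb.
Qed.

Lemma stabilizes_clifford_adj U u f s v : clifford_over U u -> stabilizes (u f) s v ->
  exists t, stabilizes f t (op_app (op_adj U) v).
Proof.
move=> Uu fv; have [r rP] := clifford_intertwine f Uu; exists (r (+) s).
have e : op_mul (sigma f) (op_adj U)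
       = op_scale ((-1) ^+ r) (op_mul (op_adj U) (sigma (u f))).
  rewrite -[LHS]op_mul1l -(clifford_adjl Uu) -op_mulA (op_mulA U) rP.
  by rewrite op_mulZl op_mulZr -op_mulA Uu.1 op_mul1r.
rewrite /stabilizes -op_appM e op_appZ op_appM fv op_app_scale.
by apply: functional_extensionality => x; rewrite mulrA signr_addb.
Qed.

Lemma stabilizes_sigma f h s v : stabilizes f s v ->
  stabilizes f (omega f h (+) s) (op_app (sigma h) v).
Proof.
move=> fv; rewrite /stabilizes -op_appM sigmaC op_appZ op_appM fv op_app_scale.
by apply: functional_extensionality => x; rewrite mulrA signr_addb.
Qed.

(** The product relation is compared at a point where [v] is nonzero. The failure of the signs to be
    additive is thus governed by [phase] alone, so two sign functions on one group differ by a
    character. *)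
Lemma stabilizes_phase f g r s t v : inner v v = 1 ->
  stabilizes f r v -> stabilizes g s v -> stabilizes (padd f g) t v ->
  phase C f g = (-1) ^+ (r (+) s (+) t).
Proof.
move=> /inner1_neq0[x vx] fv gv fgv.
have := congr1 (@^~ x) (stabilizesM fv gv); rewrite /= fgv mulrA => /(mulIf vx) e.
by rewrite signr_addb -e -mulrA -expr2 sqrr_sign mulr1.
Qed.

End StabilizedStates.

(** * Factoring a state across the splitting *)

Section Factorization.
Variables (C : numClosedFieldType) (Q1 Q2 Q : finType).
Variables (pi : Q1 + Q2 -> Q) (pi' : Q -> Q1 + Q2).
Hypotheses (piK : cancel pi pi') (pi'K : cancel pi' pi).
Local Notation join := (join pi').

Lemma phase_joinl f g : phase C (join f (pzero Q2)) (join g (pzero Q2)) = phase C f g.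
Proof.
rewrite /phase (big_split_qubits piK pi'K) -[RHS]mulr1; congr *%R.
  by apply: eq_bigr => q _; rewrite !ffunE piK.
by apply: big1 => q _; rewrite !ffunE piK !ffunE.
Qed.

Lemma stabilizes_joinl f s (v : state C Q1) (w : state C Q2) :
  stabilizes f s v -> stabilizes (join f (pzero Q2)) s (relabel pi (tensor_state v w)).
Proof.
move=> fv; apply: (eq_state_join pi'K) => x y.
rewrite (op_app_joinl piK pi'K) (relabel_tensorE piK) mulrA.
transitivity (op_app (sigma C f) (fun x' => w y * v x') x).
  by congr (op_app _ _ x); apply: functional_extensionality => x';
     rewrite (relabel_tensorE piK) mulrC.
by rewrite op_app_scale fv mulrC.
Qed.

(** At an [x] with [v x] nonzero, the slice of the product state is a nonzero multiple of [w], so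
    the eigenvalue equation descends to [w]. *)
Lemma stabilizes_joinr g s (v : state C Q1) (w : state C Q2) : inner v v = 1 ->
  stabilizes (join (pzero Q1) g) s (relabel pi (tensor_state v w)) -> stabilizes g s w.
Proof.
move=> /inner1_neq0[x vx] gvw; apply: functional_extensionality => y.
apply: (mulfI vx); have := congr1 (@^~ (join x y)) gvw.
rewrite /= (op_app_joinr piK pi'K) (relabel_tensorE piK) mulrCA => <-.
transitivity (op_app (sigma C g) (fun y' => v x * w y') y); first by rewrite op_app_scale.
by congr (op_app _ _ y); apply: functional_extensionality => y'; rewrite (relabel_tensorE piK).
Qed.

Lemma inner_tensor (v : state C Q1) (w : state C Q2) :
  inner (relabel pi (tensor_state v w)) (relabel pi (tensor_state v w))
  = inner v v * inner w w.
Proof.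
rewrite /inner (sum_join piK pi'K) mulr_suml; apply: eq_bigr => x _.
rewrite mulr_sumr; apply: eq_bigr => y _; rewrite (relabel_tensorE piK) rmorphM.
by rewrite mulrACA.
Qed.

(* Each slice [x |-> Phi (x, y)] is stabilized like [v], hence proportional to it. *)
Lemma stabilized_factor S eps (v : state C Q1) (Phi : state C Q) :
  self_dual S -> inner v v = 1 -> {in S, forall f, stabilizes f (eps f) v} ->
  {in S, forall f, stabilizes (join f (pzero Q2)) (eps f) Phi} ->
  exists w, Phi = relabel pi (tensor_state v w).
Proof.
move=> Sd v1 vS PhiS; exists (fun y => inner v (fun x => Phi (join x y))).
apply: (eq_state_join pi'K) => x y; rewrite (relabel_tensorE piK) mulrC.
have slice : {in S, forall f, stabilizes f (eps f) (fun x => Phi (join x y))}.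
  move=> f fS; apply: functional_extensionality => x'.
  by rewrite -(op_app_joinl piK pi'K) PhiS.
exact: (congr1 (@^~ x) (stab_state_unique Sd v1 vS slice)).
Qed.

(** The preimage of [S] under [u] is self-dual and contains $S_1\oplus 0$. First components of its
    elements are orthogonal to $S_1$, hence in $S_1$, so the preimage is $S_1\oplus S_2$ and $S_2$
    inherits self-duality. *)
Lemma self_dual_split (S : {set pauli Q}) (S1 : {set pauli Q1}) (u : pauli Q -> pauli Q) :
  self_dual S -> self_dual S1 ->
  (forall f g, omega (u f) (u g) = omega f g) ->
  (forall f g, u (padd f g) = padd (u f) (u g)) -> injective u ->
  {in S1, forall f, u (join f (pzero Q2)) \in S} ->
  self_dual [set g | u (join (pzero Q1) g) \in S].
Proof.
move=> Sd S1d u_omega uD u_inj S1S; have [_ SD] := self_dual_closed Sd.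
have S0 f g : f \in S -> g \in S -> omega f g = false.
  by rewrite -{1}Sd => /perpP; apply.
apply/setP=> g; rewrite [in RHS]inE; apply/perpP/idP => [gS|gS h]; last first.
  rewrite inE => hS; have := S0 _ _ gS hS.
  by rewrite u_omega (omega_join piK pi'K) omega0l.
rewrite -Sd; apply/perpP=> s sS.
have [u' _ uK] := injF_bij u_inj; have [t e_s] : exists t, s = u t by exists (u' s).
pose f := joinl pi t; pose g' := joinr pi t.
have e_t : t = join f g' by rewrite joinK.
have fS1 : f \in S1.
  rewrite -S1d; apply/perpP=> f' f'S1; have := S0 _ _ sS (S1S _ f'S1).
  by rewrite e_s e_t u_omega (omega_join piK pi'K) omega0r addbF.
rewrite e_s e_t u_omega (omega_join piK pi'K) omega0l gS //.
rewrite inE; suff -> : join (pzero Q1) g' = padd (join f (pzero Q2)) t.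
  by rewrite uD -e_s SD // S1S.
by rewrite e_t padd_join paddff paddC padd0.
Qed.

End Factorization.

(** Within each party, the qubit of [Q1] at a given position of the enumeration goes to the qubit of
    [Q] at the same position. The qubits not reached are numbered to form the second subsystem. *)
Lemma split_parties (M Q1 Q : finType) (own1 : Q1 -> M) (own : Q -> M) :
  (forall a, #|[set q | own1 q == a]| <= #|[set q | own q == a]|)%N ->
  exists m (own2 : 'I_m -> M) (pi : Q1 + 'I_m -> Q),
    bijective pi /\ forall r, own (pi r) = sum_owner own1 own2 r.
Proof.
move=> le_own; pose A1 a := [set q | own1 q == a]; pose A a := [set q | own q == a].
have [j jP] : exists j : Q1 -> Q, forall q, own (j q) = own1 q /\
    index (j q) (enum (A (own1 q))) = index q (enum (A1 (own1 q))).
  apply: (fin_all_exists (P := fun q r => own r = own1 q /\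
      index r (enum (A (own1 q))) = index q (enum (A1 (own1 q))))) => q.
  have lt_q : (index q (enum (A1 (own1 q))) < #|A (own1 q)|)%N.
    by apply: leq_trans (le_own _); rewrite [X in (_ < X)%N]cardE index_mem mem_enum inE.
  exists (enum_val (Ordinal lt_q)); split.
    by have := enum_valP (Ordinal lt_q); rewrite inE => /eqP.
  by rewrite (enum_val_nth (enum_val (Ordinal lt_q))) index_uniq ?enum_uniq -?cardE.
have j_inj : injective j.
  move=> q r eq_j; have [jq iq] := jP q; have [jr ir] := jP r.
  have eq_own : own1 q = own1 r by rewrite -jq eq_j.
  have qA : q \in enum (A1 (own1 q)) by rewrite mem_enum inE.
  have rA : r \in enum (A1 (own1 q)) by rewrite mem_enum inE eq_own.
  by rewrite -(nth_index q qA) -iq eq_j eq_own ir -eq_own nth_index.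
pose B := ~: (j @: setT); pose pi (r : Q1 + 'I_#|B|) :=
  match r with inl q => j q | inr i => enum_val i end.
have jB q : j q \notin B by rewrite inE negbK imset_f.
have pi_inj : injective pi.
  move=> [q|i] [r|i'] /= e; first by rewrite (j_inj _ _ e).
  - by have := jB q; rewrite e enum_valP.
  - by have := jB r; rewrite -e enum_valP.
  - by rewrite (enum_val_inj e).
exists #|B|, (fun i => own (enum_val i)), pi; split.
  apply: inj_card_bij pi_inj _.
  by rewrite card_sum card_ord -(cardsC (j @: setT)) card_imset // cardsT.
by case=> [q|i] //=; have [] := jP q.
Qed.

(** Witt's theorem is applied in each party to the graph of restrictions of [T1 f] and [T2 f]. That
    these vanish together makes the correspondence well defined and injective. *)
Lemma local_witt (C : numClosedFieldType) (M Q' Q : finType) (own : Q -> M)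
    (S : {set pauli Q'}) (T1 T2 : pauli Q' -> pauli Q) :
  padd_closed S ->
  {in S &, forall f g, T1 (padd f g) = padd (T1 f) (T1 g)} ->
  {in S &, forall f g, T2 (padd f g) = padd (T2 f) (T2 g)} ->
  (forall a, {in S, forall f, restr_pauli own a (T1 f) = pzero _
                              <-> restr_pauli own a (T2 f) = pzero _}) ->
  (forall a, {in S &, forall f g,
     omega (restr_pauli own a (T1 f)) (restr_pauli own a (T1 g))
     = omega (restr_pauli own a (T2 f)) (restr_pauli own a (T2 g))}) ->
  exists U : forall a, op C (party_qubits own a), exists u,
    (forall a, clifford_over (U a) (u a)) /\ {in S, forall f, local_map u (T1 f) = T2 f}.
Proof.
move=> [_ SD] T1D T2D T0 Tomega.
have [hs hsP] : exists hs : forall a, seq (pauli (party_qubits own a)),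
    forall a, {in S, forall f, transvections (hs a) (restr_pauli own a (T1 f))
                               = restr_pauli own a (T2 f)}.
  apply: (fin_all_exists (P := fun a hs =>
    {in S, forall f, transvections hs (restr_pauli own a (T1 f))
                     = restr_pauli own a (T2 f)})) => a.
  have [|||hs hsP] := @witt_transvections _
    [set (restr_pauli own a (T1 f), restr_pauli own a (T2 f)) | f in S].
  - move=> _ _ /imsetP[f fS ->] /imsetP[g gS ->] /=; apply/imsetP.
    by exists (padd f g); rewrite ?SD // T1D // T2D // !restr_pauliD.
  - by move=> _ /imsetP[f fS ->]; apply: T0.
  - by move=> _ _ /imsetP[f fS ->] /imsetP[g gS ->]; apply: Tomega.
  by exists hs => f fS; apply: (hsP (_, _)); apply: imset_f.
exists (fun a => foldr (fun h => op_mul (transvection_op C h)) (@op_id C _) (hs a)).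
exists (fun a => transvections (hs a)); split=> [a|f fS].
  exact: clifford_transvections.
by apply/ffunP=> q; rewrite ffunE hsP // ffunE.
Qed.

(** * The two directions of the criterion *)

Lemma extractable_isometry (C : numClosedFieldType) (M : finType) (n k : nat)
    (own : 'I_n -> M) (own' : 'I_k -> M)
    (Psi : state C 'I_n) (Psi' : state C 'I_k)
    (S : {set pauli 'I_n}) (S' : {set pauli 'I_k}) :
  is_stab_state S Psi -> is_stab_state S' Psi' -> extractable own own' Psi Psi' ->
  exists T : pauli 'I_k -> pauli 'I_n,
    [/\ lin_inj_into S' S T,
        forall a : M, {in S' &, forall f g,
          omega (restr_pauli own a (T f)) (restr_pauli own a (T g))
          = omega (restr_pauli own' a f) (restr_pauli own' a g)} &
        forall a : M, colocal own a (T @: S') = T @: colocal own' a S'].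
Proof.
move=> PsiS /stab_stateP[S'd Psi'1 [eps' Psi'S']].
case=> m [own'' [Psi'' [pi [_ [pi' piK pi'K] own_pi [U [Ucl [c [c1 PsiE]]]]]]]].
have [u Uu] := fin_all_exists (fun a => (cliffordP (U a)).1 (Ucl a)).
have Ww := clifford_local Uu.
pose T f := local_map u (join pi' f (pzero 'I_m)).
have TD f g : T (padd f g) = padd (T f) (T g).
  by rewrite -(cliffordD _ _ Ww) padd_join paddff.
have T_inj : injective T.
  by move=> f g /(clifford_inj Ww) /(congr1 (fun z => joinl pi z)); rewrite !(joinlK piK).
have restrT a f : restr_pauli own a (T f)
    = u a (restr_pauli own a (join pi' f (pzero 'I_m))) by rewrite restr_glue.
(* Each [u a] is injective and fixes zero, so [T] neither creates nor destroys vanishing at a party.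
   This gives (ii). *)
have restrT0 a f : restr_pauli own a (T f) = pzero _ <-> restr_pauli own' a f = pzero _.
  rewrite restrT; have u0 : u a (pzero _) = pzero _.
    by rewrite -[in LHS](paddff (pzero _)) (cliffordD _ _ (Uu a)) paddff.
  split=> [f0|/(restr_joinl_eq0 piK pi'K own_pi) -> //].
  apply/(restr_joinl_eq0 piK pi'K own_pi)/(clifford_inj (Uu a)).
  by rewrite f0 u0.
exists T; split=> [|a f g fS' gS'|a].
- split=> [f g _ _|f g _ _|]; [exact: TD|exact: T_inj|].
  apply/subsetP=> _ /imsetP[f fS' ->].
  have [s sP] := stabilizes_clifford Ww (stabilizes_joinl piK pi'K Psi'' (Psi'S' f fS')).
  apply: (stab_state_mem PsiS (s := s)).
  have -> : Psi = fun x => c * op_app (local_op U)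
      (relabel pi (tensor_state Psi' Psi'')) x.
    by apply: functional_extensionality => x; rewrite PsiE.
  exact: stabilizes_scale.
- by rewrite !restrT (clifford_omega _ _ (Uu a)) (omega_restr_joinl piK pi'K own_pi).
- apply/setP=> g; rewrite inE; apply/andP/imsetP.
    case=> /imsetP[f fS' ->] /eqP /restrT0 f0; exists f => //.
    by rewrite inE fS' f0 eqxx.
  case=> f; rewrite inE => /andP[fS' /eqP f0] ->; rewrite imset_f //; split=> //.
  by apply/eqP/restrT0.
Qed.

Lemma isometry_extractable (C : numClosedFieldType) (M : finType) (n k : nat)
    (own : 'I_n -> M) (own' : 'I_k -> M)
    (Psi : state C 'I_n) (Psi' : state C 'I_k)
    (S : {set pauli 'I_n}) (S' : {set pauli 'I_k}) (T : pauli 'I_k -> pauli 'I_n) :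
  is_stab_state S Psi -> is_stab_state S' Psi' ->
  (forall a : M, #|[set q | own' q == a]| <= #|[set q | own q == a]|)%N ->
  lin_inj_into S' S T ->
  (forall a : M, {in S' &, forall f g,
     omega (restr_pauli own a (T f)) (restr_pauli own a (T g))
     = omega (restr_pauli own' a f) (restr_pauli own' a g)}) ->
  (forall a : M, colocal own a (T @: S') = T @: colocal own' a S') ->
  extractable own own' Psi Psi'.
Proof.
move=> /stab_stateP[Sd Psi1 [eps PsiS]] /stab_stateP[S'd Psi'1 [eps' Psi'S']] le_own.
case=> TD T_inj TS Tomega Tcolocal.
have S'_closed := self_dual_closed S'd.
have [m [own'' [pi [[pi' piK pi'K] own_pi]]]] := split_parties le_own.
pose emb (f : pauli 'I_k) : pauli 'I_n := join pi' f (pzero 'I_m).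
have embD f g : emb (padd f g) = padd (emb f) (emb g).
  by rewrite padd_join paddff.
have [||U [u [Uu uT]]] := @local_witt C M _ _ own S' emb T S'_closed (in2W embD) TD.
(* Both implications come from (ii): one inclusion carries vanishing from [f] to [T f], the other
   carries it back because [T] is injective on [S']. *)
- move=> a f fS'; split.
    move=> /(restr_joinl_eq0 piK pi'K own_pi) f0.
    have : T f \in colocal own a (T @: S').
      by rewrite Tcolocal imset_f // inE fS' f0 eqxx.
    by rewrite inE => /andP[_ /eqP].
  move=> Tf0; apply/(restr_joinl_eq0 piK pi'K own_pi).
  have : T f \in colocal own a (T @: S') by rewrite inE imset_f //= Tf0.
  rewrite Tcolocal => /imsetP[g]; rewrite inE => /andP[gS' /eqP g0] /T_inj -> //.
- by move=> a f g fS' gS'; rewrite (omega_restr_joinl piK pi'K own_pi) Tomega.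
have Ww := clifford_local Uu.
set W := local_op U in Ww; set w := local_map u in Ww uT.
pose Psi_1 := op_app (op_adj W) Psi.
have Psi_11 : inner Psi_1 Psi_1 = 1.
  by rewrite inner_unitary // op_adjK Ww.1.
have [delta deltaP] : exists delta : pauli 'I_k -> bool,
    forall f, f \in S' -> stabilizes (emb f) (delta f) Psi_1.
  (* Outside [S'] the sign is a dummy, chosen as [false]. *)
  apply: (fin_all_exists (P := fun f s => f \in S' -> stabilizes (emb f) s Psi_1)) => f.
  have [fS'|] := boolP (f \in S'); last by exists false.
  have TfS : T f \in S by apply: (subsetP TS); apply: imset_f.
  have := PsiS _ TfS; rewrite -uT // => /(stabilizes_clifford_adj Ww)[s sP].
  by exists s.
(* The signs of [Psi_1] and those of [Psi'] deviate from additivity by the same phase, since padding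
   with the identity does not change [phase]; their difference is additive. *)
have [|h hP] := @additive_omega _ S' (fun f => delta f (+) eps' f) S'_closed.
  move=> f g fS' gS'; have fgS' := S'_closed.2 f g fS' gS'.
  have := stabilizes_phase Psi'1 (Psi'S' f fS') (Psi'S' g gS') (Psi'S' _ fgS').
  have := deltaP _ fgS'; rewrite embD => delta_fg.
  rewrite -(phase_joinl C piK pi'K).
  rewrite (stabilizes_phase Psi_11 (deltaP f fS') (deltaP g gS') delta_fg) => /signr_inj.
  by move: (delta _) (delta f) (delta g) (eps' _) (eps' f) (eps' g) => [] [] [] [] [] [].
(* Conjugation by a Pauli changes only signs, so [V] keeps the label map [w] while the signs on [S']
   become [eps']. *)
pose V := op_mul W (sigma C (emb h)).
have Vw : clifford_over V w := clifford_mul Ww (clifford_sigma C (emb h)).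
pose Psi_2 := op_app (op_adj V) Psi.
have Psi_2E : Psi_2 = op_app (sigma C (emb h)) Psi_1.
  by rewrite /Psi_2 op_adjM sigma_adj op_appM.
have Psi_21 : inner Psi_2 Psi_2 = 1 by rewrite inner_unitary // op_adjK Vw.1.
have [|Psi'' factor] := @stabilized_factor C _ _ _ pi pi' piK pi'K S' eps' Psi' Psi_2
  S'd Psi'1 Psi'S'.
  move=> f fS'; rewrite Psi_2E; have := stabilizes_sigma (emb h) (deltaP f fS').
  rewrite (omega_join piK pi'K) omega0l addbF -hP //.
  by rewrite addbC addbA addbb.
exists m, own'', Psi'', pi; split=> //.
(* The stabilizer group of [Psi''] consists of the labels that, padded by zero on the first
   subsystem, are sent into [S] by [w]. *)
- exists [set g | w (join pi' (pzero 'I_k) g) \in S]; apply/stab_stateP; split.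
  + apply: (self_dual_split piK pi'K Sd S'd) => [f g|f g||f fS'].
    * exact: clifford_omega Ww.
    * exact: cliffordD Ww.
    * exact: clifford_inj Ww.
    * by rewrite uT //; apply: (subsetP TS); apply: imset_f.
  + by move: Psi_21; rewrite factor (inner_tensor piK pi'K) Psi'1 mul1r.
  + apply: (fin_all_exists (P := fun g s => g \in _ -> stabilizes g s Psi'')) => g.
    have [gS|] := boolP (g \in _); last by exists false.
    move: gS; rewrite inE => /PsiS /(stabilizes_clifford_adj Vw)[s].
    rewrite -/Psi_2 factor => /(stabilizes_joinr piK pi'K Psi'1) gs.
    by exists s.
- by exists pi'.
exists (fun a => op_mul (U a) (sigma C (restr_pauli own a (emb h)))); split=> [a|].
  by apply/cliffordP; exists (u a \o id); apply: clifford_mul (Uu a) (clifford_sigma _ _).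
exists 1; split=> [|x]; first exact: normr1.
rewrite mul1r -local_op_mul sigma_local -/W -/V -factor /Psi_2 -op_appM Vw.1.
by rewrite op_app1.
Qed.

Theorem theorem2 (C : numClosedFieldType) (M : finType) (n k : nat)
    (own : 'I_n -> M) (own' : 'I_k -> M)
    (Psi : state C 'I_n) (Psi' : state C 'I_k)
    (S : {set pauli 'I_n}) (S' : {set pauli 'I_k}) :
  is_stab_state S Psi ->
  is_stab_state S' Psi' ->
  (forall a : M, #|[set q | own' q == a]| <= #|[set q | own q == a]|)%N ->
  extractable own own' Psi Psi' <->
  exists T : pauli 'I_k -> pauli 'I_n,
    [/\ lin_inj_into S' S T,
        forall a : M, {in S' &, forall f g,
          omega (restr_pauli own a (T f)) (restr_pauli own a (T g))
          = omega (restr_pauli own' a f) (restr_pauli own' a g)} &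
        forall a : M, colocal own a (T @: S') = T @: colocal own' a S'].
Proof.
move=> PsiS Psi'S' le_own; split; first exact: extractable_isometry.
by case=> T [T_lin T_omega T_colocal]; exact: isometry_extractable T_lin T_omega T_colocal.
Qed.
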